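(* Let $\rho$ be a density operator on $\mathbf{H}$. For each integer $k\ge 1$ let $B_k$ be the minimal point on $\mathcal{E}$ of the function $$G_k(X)=\int_{\mathbf{P}}\left(1+\frac{\operatorname{Tr}(XP)}{2k}\right)^{2k}d\sigma(P)-\operatorname{Tr}(X\rho),$$ and let $$G(X)=\int_{\mathbf{P}} e^{\operatorname{Tr}(XP)}\,d\sigma(P)-\operatorname{Tr}(X\rho),\qquad X\in\mathcal{E}.$$ If the sequence $(B_k)_{k\ge1}$ is bounded, then it converges, and the function $G$ has a strict minimum on $\mathcal{E}$ at $B=\lim_{k\to\infty}B_k$.
   Context: Let $\mathbf{H}=H^{(1)}\otimes\cdots\otimes H^{(N)}$ be a tensor product of finitely many nonzero finite-dimensional complex Hilbert spaces, and let $\mathcal{E}$ be the (finite-dimensional real) vector space of self-adjoint operators on $\mathbf{H}$. $\mathbf{P}$ denotes the compact set of all pure product states, i.e. operators $P=P^{(1)}\otimes\cdots\otimes P^{(N)}$ where each $P^{(I)}$ is a one-dimensional orthogonal projector in $H^{(I)}$. $\sigma$ is the probability measure on $\mathbf{P}$ invariant under all local unitary transformations $P\mapsto (U_1\otimes\cdots\otimes U_N)P(U_1\otimes\cdots\otimes U_N)^*$, $U_I$ unitary on $H^{(I)}$ (it is unique since the action is transitive). A density operator is a positive semidefinite operator on $\mathbf{H}$ of trace $1$. For every $k\ge1$ the function $G_k$ has exactly one minimal point on $\mathcal{E}$, so $B_k$ is well defined. A function $F$ on $\mathcal{E}$ has a strict minimum at $B$ if $F(X)>F(B)$ for all $X\in\mathcal{E}$,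 $X\neq B$. *)

(* Defs.v *)
From HB Require Import structures.
From mathcomp Require Import all_boot all_order all_algebra.
From mathcomp Require Import complex.
From mathcomp Require Import all_classical all_reals all_analysis.

Set Implicit Arguments.
Unset Strict Implicit.
Unset Printing Implicit Defensive.

Import Order.TTheory GRing.Theory Num.Theory.
Import numFieldNormedType.Exports.

Local Open Scope classical_set_scope.
Local Open Scope sesquilinear_scope.
Local Open Scope ring_scope.

(* Going through a constant of type [numClosedFieldType] lets the canonical
   topology of number fields, hence the entrywise topology and the sup norm of
   matrices, be inferred; no such instance is keyed on [_[i]] itself. *)
Definition cplx (R : realType) : numClosedFieldType := R[i].

(* The I-th factor is C^(d I).  The product basis e_(f 0) (x) e_(f 1) (x) ...
   is indexed by the multi-indices f, enumerated by [enum_val]. *)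
Definition mindex (N : nat) (d : 'I_N -> nat) : finType :=
  {dffun forall I : 'I_N, 'I_(d I)}.

Definition op (R : realType) (N : nat) (d : 'I_N -> nat) :=
  'M[cplx R]_#|mindex d|.

Section Operators.
Variables (R : realType) (N : nat) (d : 'I_N -> nat).
Local Notation C := (cplx R).
Local Notation op := (op R d).

Definition tensor (A : forall I : 'I_N, 'M[C]_(d I)) : op :=
  \matrix_(a, b) \prod_(I < N)
    A I ((enum_val a : mindex d) I) ((enum_val b : mindex d) I).

Definition selfadjoint : set op := [set X | X \is hermsymmx].

Definition rank1_projector (n : nat) (P : 'M[C]_n) : Prop :=
  [/\ P \is hermsymmx, P *m P = P & \rank P = 1%N].

Definition pure_product : set op :=
  [set P | exists2 p : forall I : 'I_N, 'M[C]_(d I),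
     (forall I, rank1_projector (p I)) & P = tensor p].

Definition psd (X : op) : Prop :=
  X \is hermsymmx /\
  forall v : 'cV[C]_#|mindex d|, 0 <= (v^t* *m X *m v) ord0 ord0.

Definition density (rho : op) : Prop := psd rho /\ \tr rho = 1.

Definition conj_by (U X : op) : op := U *m X *m U^t*.

(* Tr(XY), which is real when X and Y are self-adjoint. *)
Definition trp (X Y : op) : R := complex.Re (\tr (X *m Y)).

(* The pure product states form a compact, hence Borel, set of operators, so the
   measure is taken on the Borel sigma-algebra of all operators and required to
   be carried by that set. *)
Definition borel_op := g_sigma_algebraType (@open op).

Definition invariant_pure_measure (sigma : probability borel_op R) : Prop :=
  sigma (pure_product : set borel_op) = 1%E /\
  forall U : forall I : 'I_N, 'M[C]_(d I), (forall I, U I \is unitarymx) ->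
  forall A : set borel_op, measurable A ->
  pushforward sigma (conj_by (tensor U) : borel_op -> borel_op) A = sigma A.

Definition Gk (sigma : probability borel_op R) (rho : op) (k : nat)
    (X : op) : R :=
  \int[sigma]_(P in pure_product) (1 + trp X P / (2 * k)%:R) ^+ (2 * k)
  - trp X rho.

Definition Ginf (sigma : probability borel_op R) (rho : op) (X : op) : R :=
  \int[sigma]_(P in pure_product) expR (trp X P) - trp X rho.

Definition minimal_point (F : op -> R) (B : op) : Prop :=
  selfadjoint B /\ forall X, selfadjoint X -> F B <= F X.

Definition strict_minimum (F : op -> R) (B : op) : Prop :=
  selfadjoint B /\ forall X, selfadjoint X -> X <> B -> F B < F X.

End Operators.

(* Main.v *)
Require Import Defs.
From HB Require Import structures.
From mathcomp Require Import all_boot all_order all_algebra.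
From mathcomp Require Import complex.
From mathcomp Require Import all_classical all_reals all_analysis.
From mathcomp Require Import ring lra.

Set Implicit Arguments.
Unset Strict Implicit.
Unset Printing Implicit Defensive.

Import Order.TTheory GRing.Theory Num.Theory.
Import numFieldNormedType.Exports.

Local Open Scope classical_set_scope.
Local Open Scope ring_scope.
Local Open Scope sesquilinear_scope.

(* On bounded sets (1 + t/2k)^(2k) <= exp t <= (1 + t/2k)^(2k) + O(1/k), and the
   traces Tr(XP) are uniformly bounded over pure product states P.  Hence
   G(B_k) <= G_k(B_k) + O(1/k) <= G_k(X) + O(1/k) <= G(X) + O(1/k) for every X,
   so every cluster point of (B_k) minimizes G.  Since G is strictly convex it
   has at most one minimizer, and the bounded sequence (B_k) converges to it.
   Strict convexity amounts to: if Tr(ZP) = 0 almost surely then Z = 0. *)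

(** The delicate point is the last one. [sigma] is known only through its invariance, so neither a
    density nor full support is at hand, and every [Z] has its own exceptional set of states.
    Transporting one good state by local unitaries involves uncountably many conjugates of [Z],
    hence uncountably many null sets; finite dimension reduces them to finitely many, whose union is
    still null. Two algebraic facts finish the argument: local unitaries act transitively on pure
    product states, and these states span all operators over the complex numbers, by polarization in
    one tensor factor after another. The comparison of [G_k] with [G] rests on 1 + x <= e^x in one
    direction and on Bernoulli's inequality for (1 - x^2)^n, with x = t/n, in the other. A one-sided
    Lipschitz estimate of [G] at the cluster point carries the inequalities from [B_k] to the
    limit. *)

(** Rows taken from [S] with the largest possible rank: one more row from [S] cannot enlarge their
    span. This replaces an infinite family of matrices, each with its own null set, by finitely
    many. *)
Lemma exists_spanning_mx (F : fieldType) (n : nat) (S : set 'rV[F]_n) :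
  exists m (A : 'M[F]_(m, n)),
    (forall i, S (row i A)) /\ (forall v, S v -> (v <= A)%MS).
Proof.
pose P r := `[< exists m (A : 'M[F]_(m, n)),
  (forall i, S (row i A)) /\ \rank A = r >].
have P0 : exists r, P r.
  exists 0%N; apply/asboolP; exists 0%N, 0; split; first by case.
  exact: mxrank0.
have Pn r : P r -> (r <= n)%N.
  by move=> /asboolP[m [A [_ <-]]]; exact: rank_leq_col.
case: (ex_maxnP P0 Pn) => r /asboolP[m [A [SA rA]]] rmax.
exists m, A; split=> // v Sv.
have leA : (A <= col_mx A v)%MS by rewrite -addsmxE addsmxSl.
have : (\rank (col_mx A v) <= \rank A)%N.
  rewrite rA; apply: rmax; apply/asboolP; exists (m + 1)%N, (col_mx A v).
  split=> // i; case: (split_ordP i) => j ->; first by rewrite rowKu.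
  by rewrite rowKd (_ : row j v = v) //; apply/rowP => k; rewrite mxE ord1.
rewrite (geq_leqif (mxrank_leqif_sup leA)) => /(submx_trans _); apply.
by rewrite -addsmxE addsmxSr.
Qed.

(** * Rank-one projectors: unitary transitivity and linear span *)

Section RankOneProjectors.
Variable C : numClosedFieldType.

Lemma trmxC_mul m n p (A : 'M[C]_(m, n)) (B : 'M[C]_(n, p)) :
  (A *m B)^t* = B^t* *m A^t*.
Proof. by rewrite trmx_mul map_mxM. Qed.

Lemma trmxCD m n (A B : 'M[C]_(m, n)) : (A + B)^t* = A^t* + B^t*.
Proof. by rewrite linearD map_mxD. Qed.

Lemma trmxCZ m n (c : C) (A : 'M[C]_(m, n)) : (c *: A)^t* = c^* *: A^t*.
Proof. by rewrite linearZ map_mxZ. Qed.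

Lemma hermsymmx_trmxC n (X : 'M[C]_n) : (X \is hermsymmx) = (X^t* == X).
Proof. by rewrite qualifE /= expr0 scale1r eq_sym. Qed.

Definition unit_row n (v : 'rV[C]_n) := v *m v^t* = 1%:M.

(** For a unit row this is the state |psi><psi| with psi = [v^t*]. *)
Definition proj_row n (v : 'rV[C]_n) : 'M[C]_n := v^t* *m v.

Lemma row_self_dot n (v : 'rV[C]_n) :
  (v *m v^t*) 0 0 = \sum_i `|v 0 i| ^+ 2.
Proof. by rewrite mxE; apply: eq_bigr => i _; rewrite !mxE normCK. Qed.

Lemma row_self_dot_gt0 n (v : 'rV[C]_n) : v != 0 -> 0 < (v *m v^t*) 0 0.
Proof.
move=> v0; rewrite lt_def row_self_dot sumr_ge0 ?andbT; last first.
  by move=> i _; rewrite exprn_ge0.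
apply: contra v0; rewrite psumr_eq0 => [/allP h|i _]; last by rewrite exprn_ge0.
apply/eqP/rowP => i; have := h i (mem_index_enum _).
by rewrite /= sqrf_eq0 normr_eq0 mxE => /eqP.
Qed.

Definition normalize_row n (v : 'rV[C]_n) : 'rV[C]_n :=
  (sqrtC ((v *m v^t*) 0 0))^-1 *: v.

Lemma normalize_row_proj n (v : 'rV[C]_n) : v != 0 ->
  unit_row (normalize_row v) /\
  proj_row (normalize_row v) = ((v *m v^t*) 0 0)^-1 *: proj_row v.
Proof.
rewrite /unit_row /proj_row /normalize_row => v0.
have := row_self_dot_gt0 v0; set s := (v *m v^t*) 0 0 => s0.
have cs : (sqrtC s)^-1^* = (sqrtC s)^-1.
  by apply/conj_Creal; rewrite rpredV ger0_real // sqrtC_ge0 ltW.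
have ss : (sqrtC s)^-1 * (sqrtC s)^-1 = s^-1 by rewrite -invfM -expr2 sqrtCK.
rewrite trmxCZ cs; split.
  rewrite -scalemxAl -scalemxAr scalerA ss (mx11_scalar (v *m _)) -/s.
  by rewrite scale_scalar_mx mulVf // gt_eqF.
by rewrite -scalemxAl -scalemxAr scalerA ss.
Qed.

(** Gram-Schmidt yields a unitary whose first row is the given unit row up to a phase, and phases
    cancel in [proj_row]. So both projectors are unitary conjugates of [delta_mx 0 0]. *)
Lemma unit_row_rotate n (v w : 'rV[C]_n) : unit_row v -> unit_row w ->
  exists2 U : 'M[C]_n, U \is unitarymx & proj_row w = U *m proj_row v *m U^t*.
Proof.
have std n' (u : 'rV[C]_n'.+1) : unit_row u -> exists2 U : 'M[C]_n'.+1,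
    U \is unitarymx & proj_row u = U^t* *m delta_mx 0 0 *m U.
  (* All rows of [A] equal [u]: [schmidt] returns a unitary even for this matrix of rank one, and
     only its row 0 is used. *)
  move=> uu; pose A : 'M[C]_n'.+1 := \matrix_(i, j) u 0 j.
  have rA : row 0 A = u by apply/rowP => j; rewrite !mxE.
  have sU : schmidt A \is unitarymx by exact: schmidt_unitarymx.
  exists (schmidt A) => //.
  have rU : row 0 (schmidt A) *m (row 0 (schmidt A))^t* = 1%:M.
    have /unitarymxP/matrixP/(_ 0 0) := sU.
    rewrite (mx11_scalar (row _ _ *m _)) => h; congr (_%:M); move: h.
    rewrite !mxE eqxx => h; rewrite -[RHS]h.
    by apply: eq_bigr => k _; rewrite !mxE.
  (* At index 0 the span of the rows up to that index is row 0 alone, so [u] is a multiple [c] of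
     it; both have norm one, whence [c * c^* = 1]. *)
  have := row_schmidt_sub A 0; rewrite rA (big_pred1 0) => [|k]; last first.
    by rewrite /= leqn0.
  rewrite genmxE => /sub_rVP[c uc].
  have cc : c * c^* = 1.
    move: uu; rewrite /unit_row uc trmxCZ -scalemxAl -scalemxAr.
    by rewrite rU scalerA => /matrixP/(_ 0 0); rewrite !mxE eqxx mulr1.
  rewrite /proj_row uc trmxCZ -scalemxAl -scalemxAr scalerA.
  rewrite mulrC cc scale1r.
  rewrite rowE trmxC_mul !mulmxA -(mulmxA ((schmidt A)^t*)); congr (_ *m _ *m _).
  rewrite (_ : (delta_mx 0 0)^t* = delta_mx 0 0) ?mul_delta_mx //.
  by apply/matrixP => i j; rewrite !mxE andbC rmorph_nat.
case: n v w => [v w uv uw|n v w].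
  exists 1%:M; first by apply/unitarymxP; rewrite trmx1 map_mx1 mulmx1.
  by apply/matrixP => -[].
move=> /std[U Uu ->] /std[V Vu ->]; exists (V^t* *m U).
  by apply: mul_unitarymx => //; rewrite trmxC_unitary.
by rewrite trmxC_mul trmxCK !mulmxA !mulmxtVK.
Qed.

(** Polarization: expanding [proj_row] at [u + c *: w] isolates the mixed terms [u^t* *m w], and
    matrix units are of this form. Thus rank-one projectors span all matrices. *)
Lemma linear_proj_row_eq0 n (f : 'M[C]_n -> C) :
  (forall a X Y, f (a *: X + Y) = a * f X + f Y) ->
  (forall v, unit_row v -> f (proj_row v) = 0) -> forall X, f X = 0.
Proof.
move=> flin; suff lin_eq0 (L : {linear 'M[C]_n -> C^o}) :
    (forall v, unit_row v -> L (proj_row v) = 0) -> forall X, L X = 0.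
  exact: (lin_eq0 (HB.pack_for {linear 'M[C]_n -> C^o} (f : 'M[C]_n -> C^o)
    (GRing.isLinear.Build C 'M[C]_n C^o _ (f : 'M[C]_n -> C^o) flin))).
move=> L0 X.
have Lv v : L (proj_row v) = 0.
  have [->|v0] := eqVneq v 0; first by rewrite /proj_row mulmx0 linear0.
  have [uv pv] := normalize_row_proj v0.
  have := L0 _ uv; rewrite pv linearZ => /eqP.
  by rewrite scaler_eq0 invr_eq0 gt_eqF ?row_self_dot_gt0 //= => /eqP.
have pD (u w : 'rV[C]_n) (c : C) : proj_row (u + c *: w) =
    proj_row u + (c *: (u^t* *m w) + c^* *: (w^t* *m u)) +
    (c * c^*) *: proj_row w.
  rewrite /proj_row trmxCD trmxCZ.
  rewrite mulmxDl !mulmxDr -!scalemxAl -!scalemxAr !scalerA addrA mulrC !addrA.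
  by rewrite -!addrA; congr (_ + (_ + (_ + _))); rewrite mulrC.
have Lc (u w : 'rV[C]_n) c : c * L (u^t* *m w) + c^* * L (w^t* *m u) = 0.
  have := Lv (u + c *: w); rewrite pD !linearD !linearZ /= !Lv.
  by rewrite scaler0 add0r addr0.
(* [c = 1] makes the two mixed terms opposite, [c = 'i] makes them equal; hence both vanish. *)
have Luw (u w : 'rV[C]_n) : L (u^t* *m w) = 0.
  have := Lc u w 1; rewrite conjC1 !mul1r => /eqP; rewrite addr_eq0 => /eqP h.
  have := Lc u w 'i; rewrite conjCi h mulrN mulNr -opprD => /eqP.
  rewrite oppr_eq0 -mulr2n mulrn_eq0 /= mulf_eq0 (negPf (neq0Ci _)) /= => /eqP.
  by move=> ->; rewrite oppr0.
rewrite (matrix_sum_delta X) linear_sum big1 // => i _.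
rewrite linear_sum big1 // => j _; rewrite linearZ.
rewrite (_ : delta_mx i j = (delta_mx 0 i : 'rV[C]_n)^t* *m delta_mx 0 j).
  by rewrite Luw; exact: mulr0.
rewrite (_ : (delta_mx 0 i)^t* = delta_mx i 0) ?mul_delta_mx //.
by apply/matrixP => k l; rewrite !mxE andbC rmorph_nat.
Qed.

End RankOneProjectors.

Lemma proj_row_rank1 (R : realType) n (v : 'rV[cplx R]_n) :
  unit_row v -> rank1_projector (proj_row v).
Proof.
rewrite /proj_row => uv; split.
- by rewrite hermsymmx_trmxC trmxC_mul trmxCK.
- by rewrite mulmxA -(mulmxA _ v) uv mulmx1.
- apply/eqP; rewrite eqn_leq (leq_trans (mxrankM_maxl _ _)) ?rank_leq_col //=.
  rewrite lt0n mxrank_eq0; apply/eqP => vv0.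
  have := mxrank1 (cplx R) 1.
  rewrite -uv -[v]mul1mx -uv -mulmxA -mulmxA (mulmxA _ v).
  by rewrite vv0 mul0mx mulmx0 mxrank0.
Qed.

(** Factor [p = c *m r] by rank. Idempotence gives [r *m p = r], hermitian symmetry then gives
    [p *m r^t* = r^t*], so [c] is proportional to [r^t*] and normalizing [r] yields [v]. *)
Lemma rank1_projectorP (R : realType) n (p : 'M[cplx R]_n) :
  rank1_projector p <-> exists2 v, unit_row v & p = proj_row v.
Proof.
split=> [[ph pp pr]|[v uv ->]]; last exact: proj_row_rank1.
have [r [c [r0 pcr]]] : exists (r : 'rV[cplx R]_n) (c : 'cV[cplx R]_n),
    r != 0 /\ p = c *m r.
  move: (row_base p) (col_base p) (mulmx_base p); rewrite pr => r c pcr.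
  exists r, c; split=> //; apply/eqP => r0; move: pr.
  by rewrite -pcr r0 mulmx0 mxrank0.
have c0 : c != 0.
  by apply/eqP => c0; move: pr; rewrite pcr c0 mul0mx mxrank0.
have rp : r *m p = r.
  have : c *m (r *m p - r) = 0 by rewrite mulmxBr mulmxA -pcr pp subrr.
  have /matrix0Pn[i [j cij]] := c0.
  move/matrixP/(_ i) => h; apply/rowP => k; have := h k.
  rewrite [X in X = _ -> _]mxE big_ord1 [X in _ = X -> _]mxE => /eqP.
  rewrite (ord1 j) in cij.
  rewrite mulf_eq0 (negPf cij) /= [X in X == _]mxE [in X in _ + X]mxE.
  by rewrite subr_eq0 => /eqP.
have prs : p *m r^t* = r^t*.
  rewrite -[in RHS]rp trmxC_mul; congr (_ *m _); apply/esym/eqP.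
  by rewrite -hermsymmx_trmxC.
have [ur eqr] := normalize_row_proj r0.
have rc : r^t* = (r *m r^t*) 0 0 *: c.
  by rewrite -mul_mx_scalar -mx11_scalar mulmxA -pcr prs.
exists (normalize_row r) => //; rewrite eqr /proj_row.
have := row_self_dot_gt0 r0; move: rc; set s := (r *m r^t*) 0 0 => rc s0.
by rewrite rc -scalemxAl scalerA mulVf ?scale1r // gt_eqF.
Qed.

(** * Tensor products: multiplicativity, transitivity of local unitaries, span of the product
    states *)

(** Factors may have different dimensions, so multi-indices are dependent functions. This
    distributivity turns a product of matrix products, one per factor, into a single sum over
    multi-indices. *)
Lemma bigA_distr_dffun (K : comPzSemiRingType) (I : finType) (T : I -> finType)
    (F : forall i, T i -> K) :
  \prod_i \sum_(k : T i) F i k =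
  \sum_(f : {dffun forall i, T i}) \prod_i F i (f i).
Proof.
rewrite [RHS](reindex (@dffun_of_fprod _ T)) /=; last first.
  exact/onW_bij/dffun_of_fprod_bij.
transitivity (\sum_(t : fprod T) \prod_(i in I) [ffun k => F i k] (t i));
  last first.
  by apply: eq_bigr => t _; apply: eq_bigr => i _; rewrite !ffunE.
rewrite (@big_fprod K 0 1 *%R +%R _ _ (fun i => [ffun k => F i k])).
(* Tagged pairs put the dependent sums over one type; the default [0] of [untag] is never taken,
   since every pair summed for [i] carries the tag [i]. *)
rewrite -(bigA_distr_big_dep (fun i => mem (tagged_with T i))
  (fun i => untag 0 [ffun k => F i k])).
apply: eq_bigr => i _; rewrite (big_tag (fun i k => F i k) i).
apply: eq_bigr => -[j x]; rewrite inE /= => /eqP ji; subst j.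
by rewrite /untag; case: eqP => // e; rewrite ffunE.
Qed.

Lemma trace_mul_delta (K : pzSemiRingType) m n (Z : 'M[K]_(m, n)) i j :
  \tr (Z *m delta_mx j i) = Z i j.
Proof.
rewrite /mxtrace (bigD1 i) //= mxE (bigD1 j) //= mxE !eqxx mulr1.
rewrite big1 => [|k kj]; last by rewrite mxE (negPf kj) mulr0.
rewrite big1 ?addr0 // => k ki; rewrite mxE big1 // => l _.
by rewrite mxE (negPf ki) andbF mulr0.
Qed.

Section Tensor.
Variables (R : realType) (N : nat) (d : 'I_N -> nat).
Local Notation C := (cplx R).
Local Notation op := (op R d).
Local Notation family := (forall I : 'I_N, 'M[C]_(d I)).

Lemma tensorM (A B : family) :
  tensor (fun I => A I *m B I) = tensor A *m tensor B.
Proof.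
apply/matrixP => a b; rewrite !mxE.
under eq_bigr do rewrite mxE.
rewrite bigA_distr_dffun (reindex (enum_val : 'I_#|mindex d| -> mindex d));
  last exact/onW_bij/enum_val_bij.
by apply: eq_bigr => c _; rewrite !mxE -big_split.
Qed.

Lemma tensor_delta (f g : mindex d) :
  tensor (fun I => delta_mx (f I) (g I)) =
  delta_mx (enum_rank f) (enum_rank g) :> op.
Proof.
apply/matrixP => a b; rewrite !mxE.
under eq_bigr do rewrite mxE.
have eq_rank (c : 'I_#|mindex d|) (h : mindex d) :
    (c == enum_rank h) = [forall I, (enum_val c : mindex d) I == h I].
  rewrite -(can_eq enum_valK) enum_rankK; apply/eqP/eqfunP => [->//|ch].
  exact/ffunP.
rewrite !eq_rank; case: (boolP (_ && _)) => [/andP[/eqfunP af /eqfunP bg]|].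
  by rewrite big1 // => I _; rewrite af bg !eqxx.
rewrite negb_and !negb_forall => /orP[] /existsP[I /negPf h];
  by rewrite (bigD1 I) //= h ?andbF mul0r.
Qed.

Lemma tensor_trmxC (A : family) : (tensor A)^t* = tensor (fun I => (A I)^t*).
Proof.
apply/matrixP => a b; rewrite !mxE rmorph_prod.
by apply: eq_bigr => I _; rewrite !mxE.
Qed.

Lemma conj_by_tensor (U p : family) :
  conj_by (tensor U) (tensor p) = tensor (fun I => U I *m p I *m (U I)^t*).
Proof. by rewrite /conj_by tensor_trmxC -!tensorM. Qed.

Lemma pure_product_transitive (P Q : op) :
  pure_product P -> pure_product Q ->
  exists2 U : family, (forall I, U I \is unitarymx) & Q = conj_by (tensor U) P.
Proof.
move=> [p pP ->] [q qP ->].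
have /all_sig2[U Uu qU] I :
    {U | U \is unitarymx & q I = U *m p I *m U^t*}.
  apply: cid2; have [v uv ->] := (rank1_projectorP _).1 (pP I).
  by have [w uw ->] := (rank1_projectorP _).1 (qP I); exact: unit_row_rotate.
exists U => //; rewrite conj_by_tensor; congr tensor.
by apply: functional_extensionality_dep => I.
Qed.

(** Pure product states span all operators: freeing the factors one at a time leads to tensors of
    matrix units, whose traces against [Z] are its entries. *)
Lemma pure_product_separating (Z : op) :
  (forall P, pure_product P -> \tr (Z *m P) = 0) -> Z = 0.
Proof.
move=> Z0.
(* Factors of index below [k] are arbitrary, the others are projectors. The trace is linear in
   factor [k], so polarization frees it too. *)
have ZA k : (k <= N)%N -> forall A : family,
    (forall I : 'I_N, (k <= I)%N -> rank1_projector (A I)) ->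
    \tr (Z *m tensor A) = 0.
  elim: k => [_ A pA|k IH kN A pA].
    by apply: Z0; exists A => // I; exact: pA.
  pose K := Ordinal kN.
  pose f (X : 'M[C]_(d K)) := \tr (Z *m tensor (dfwith A K X)).
  have -> : \tr (Z *m tensor A) = f (A K).
    congr (\tr (_ *m tensor _)); apply: functional_extensionality_dep => I.
    by case: dfwithP.
  apply: linear_proj_row_eq0 => [a X Y|v uv].
    have tensor_dfwithE B x y : tensor (dfwith A K B) x y =
        B ((enum_val x : mindex d) K) ((enum_val y : mindex d) K) *
        \prod_(I < N | I != K)
          A I ((enum_val x : mindex d) I) ((enum_val y : mindex d) I).
      rewrite mxE (bigD1 K) //= dfwithin; congr (_ * _); apply: eq_bigr => I IK.
      by rewrite dfwithout // eq_sym.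
    have tensorD : tensor (dfwith A K (a *: X + Y)) =
        a *: tensor (dfwith A K X) + tensor (dfwith A K Y).
      apply/matrixP => x y; rewrite [RHS]mxE [X in _ = X + _]mxE.
      by rewrite !tensor_dfwithE !mxE mulrDl mulrA.
    by rewrite /f tensorD mulmxDr -scalemxAr mxtraceD mxtraceZ.
  apply: IH => [|I kI]; first exact: ltnW.
  have [->|IK] := eqVneq I K; first by rewrite dfwithin; exact: proj_row_rank1.
  rewrite dfwithout 1?eq_sym //; apply: pA; rewrite ltn_neqAle kI andbT.
  by apply: contra IK => /eqP kI'; apply/eqP/val_inj.
apply/matrixP => a b; rewrite [RHS]mxE.
rewrite -(ZA N (leqnn N) (fun I => delta_mx ((enum_val b : mindex d) I)
  ((enum_val a : mindex d) I))); last by move=> I; rewrite leqNgt ltn_ord.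
by rewrite tensor_delta !enum_valK trace_mul_delta.
Qed.
End Tensor.

(** * Continuity and compact boxes for complex matrices *)

Section MatrixTopology.
Variable R : realType.
Local Notation C := (cplx R).

Lemma continuous_complex_Re : continuous (@complex.Re R : C -> R).
Proof.
move=> z A /(@nbhs_normP R R^o)[e /= e0 eA]; apply/(@nbhs_normP C C^o).
exists (e%:C)%C => /=; first by rewrite ltcR.
move=> w /= zw; apply: eA => /=; rewrite -ltcR; apply: le_lt_trans zw.
by have := normc_ge_Re (z - w); rewrite raddfB.
Qed.

Lemma continuous_real_complex : continuous (real_complex R : R -> C).
Proof.
move=> x A /(@nbhs_normP C C^o)[e /= e0 eA]; apply/(@nbhs_normP R R^o).
have eR : e = ((complex.Re e)%:C)%C by rewrite RRe_real // gtr0_real.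
exists (complex.Re e) => /=; first by move: e0; rewrite eR ltcR.
move=> y /= xy; apply: eA => /=; rewrite -raddfB eR normc_def /= expr0n addr0.
by rewrite sqrtr_sqr ltcR.
Qed.

Section Combinators.
Variable T : topologicalType.
Implicit Types f g : T -> C.

Lemma continuous_mulC f g :
  continuous f -> continuous g -> continuous (fun t => f t * g t).
Proof.
by move=> fc gc x; exact: (@cvgM C T (nbhs x) _ f g _ _ (fc x) (gc x)).
Qed.

Lemma continuous_subC f g :
  continuous f -> continuous g -> continuous (fun t => f t - g t).
Proof.
by move=> fc gc x; exact: (@cvgB C C^o T (nbhs x) _ f g _ _ (fc x) (gc x)).
Qed.

Lemma continuous_cstC (c : C) : continuous (fun _ : T => c).
Proof. by move=> x; exact: cvg_cst. Qed.

Lemma continuous_sumC (I : finType) (F : I -> T -> C) :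
  (forall i, continuous (F i)) -> continuous (fun t => \sum_i F i t).
Proof.
move=> Fc; apply: (@continuous_big C) => //.
exact: (@pseudometric_normed_Zmodule.add_continuous C C^o).
Qed.

Lemma continuous_prodC (I : finType) (F : I -> T -> C) :
  (forall i, continuous (F i)) -> continuous (fun t => \prod_i F i t).
Proof. by move=> Fc; apply: (@continuous_big C) => //; exact: mul_continuous. Qed.

Lemma continuous_normC f : continuous f -> continuous (fun t => `|f t| : C).
Proof.
move=> fc x; apply: (@continuous_comp T C C f Num.norm); first exact: fc.
exact: (@norm_continuous C C^o).
Qed.

Lemma continuous_conjC f : continuous f -> continuous (fun t => (f t)^*).
Proof.
move=> fc x; apply: (@continuous_comp T C C f Num.conj); first exact: fc.
move=> A /(@nbhs_normP C C^o)[e /= e0 eA]; apply/(@nbhs_normP C C^o).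
by exists e => // w /= zw; apply: eA; rewrite /= -rmorphB norm_conjC.
Qed.

Lemma continuous_ReC f : continuous f -> continuous (fun t => complex.Re (f t)).
Proof.
move=> fc x; apply: (@continuous_comp T C R f (@complex.Re R)); first exact: fc.
exact: continuous_complex_Re.
Qed.

End Combinators.

(** A square instead of a disc: it is the continuous image of a product of two real segments, hence
    compact. *)
Definition csquare (M : R) : set C :=
  [set z | `|complex.Re z| <= M /\ `|complex.Im z| <= M].

Lemma csquare_compact M : compact (csquare M).
Proof.
pose f (x : R * R) : C := (x.1%:C + 'i * x.2%:C)%C.
have -> : csquare M = f @` (`[-M, M] `*` `[-M, M]).
  apply/seteqP; split=> [z [zr zi]|_ [[x y] [/= xM yM] <-]].
    exists (complex.Re z, complex.Im z); last by rewrite [RHS]complexE.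
    by rewrite /= !in_itv /= -!ler_norml.
  by move: xM yM; rewrite /csquare /f /= !in_itv /=; simpc; rewrite !ler_norml.
apply: continuous_compact; last by apply: compact_setX; exact: segment_compact.
apply: continuous_subspaceT => x; apply: cvgD.
  by apply: continuous_comp; [exact: cvg_fst|exact: continuous_real_complex].
apply: cvgM; first exact: cvg_cst.
by apply: continuous_comp; [exact: cvg_snd|exact: continuous_real_complex].
Qed.

Lemma csquare_norm_le (z : C) (M : R) : `|z| <= (M%:C)%C -> csquare M z.
Proof.
move=> zM; split; rewrite -lecR; apply: le_trans zM; first exact: normc_ge_Re.
by rewrite normc_def lecR -sqrtr_sqr ler_wsqrtr // lerDr sqr_ge0.
Qed.

Lemma continuous_mx (T : topologicalType) (U : topologicalType) m n
    (f : T -> 'M[U]_(m, n)) :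
  (forall i j, continuous (fun t => f t i j)) -> continuous f.
Proof.
move=> fc t A [P Pt sPA]; apply: filterS sPA _.
apply: filter_forall => i; apply: filter_forall => j.
exact: (fc i j t _ (Pt i j)).
Qed.

Definition mx_box m n (M : R) : set 'M[C]_(m, n) :=
  [set X | forall i j, csquare M (X i j)].

Lemma mx_box_compact m n M : compact (@mx_box m n M).
Proof.
pose f (g : 'I_m * 'I_n -> C) : 'M[C]_(m, n) := \matrix_(i, j) g (i, j).
have -> : mx_box M = f @` [set g | forall ij, csquare M (g ij)].
  apply/seteqP; split=> [X XM|_ [g gM <-] i j]; last by rewrite mxE.
  exists (fun ij => X ij.1 ij.2); first by move=> [i j]; exact: XM.
  by apply/matrixP => i j; rewrite mxE.
apply: (@continuous_compact (prod_topology (fun=> C)) 'M[C]_(m, n) f); last first.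
  apply: (@tychonoff _ (fun=> C) (fun=> csquare M)) => ij.
  exact: csquare_compact.
apply: (@continuous_subspaceT (prod_topology (fun=> C)) 'M[C]_(m, n)).
apply: continuous_mx => i j.
have -> : (fun g => f g i j) = (fun g => g (i, j)).
  by apply/funext => g; rewrite mxE.
exact: (@proj_continuous _ (fun=> C)).
Qed.

Lemma mx_norm_entry m n (X : 'M[C]_(m, n)) i j : `|X i j| <= `|X|.
Proof.
have -> : `|X| = mx_norm X by [].
have -> : `|X i j| = (`|X (i, j).1 (i, j).2|%:nng)%:num by [].
rewrite mx_normE num_le.
exact: (le_bigmax _ (fun ij => `|X ij.1 ij.2|%:nng) (i, j)).
Qed.

End MatrixTopology.

(** * Compactness of the pure product states and uniform trace bounds *)

Section PureProductTopology.
Variables (R : realType) (N : nat) (d : 'I_N -> nat).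
Local Notation C := (cplx R).
Local Notation op := (op R d).

Lemma unit_row_entry n (v : 'rV[C]_n) i : unit_row v -> `|v 0 i| <= 1.
Proof.
move=> /matrixP/(_ 0 0); rewrite row_self_dot mxE eqxx mulr1n => v1.
rewrite -(@ler_pXn2r _ 2) ?nnegrE // expr1n -v1 (bigD1 i) //= lerDl.
by apply: sumr_ge0 => j _; rewrite exprn_ge0.
Qed.

Lemma unit_row_compact n : compact [set v : 'rV[C]_n | unit_row v].
Proof.
apply: (@subclosed_compact _ _ (mx_box 1)); last 2 first.
- exact: mx_box_compact.
- by move=> v uv i j; rewrite ord1; apply: csquare_norm_le; exact: unit_row_entry.
have -> : [set v : 'rV[C]_n | unit_row v] =
    (fun v : 'rV[C]_n => \sum_i `|v 0 i| * `|v 0 i|) @^-1` [set 1].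
  apply/seteqP; split=> v /=; rewrite /unit_row (mx11_scalar (v *m _)).
    by move=> /matrixP/(_ 0 0); rewrite row_self_dot !mxE eqxx !mulr1n.
  by move=> <-; rewrite row_self_dot.
apply: (continuous_closedP _).1.
  by apply: continuous_sumC => i; apply: continuous_mulC;
    apply: continuous_normC; exact: coord_continuous.
apply: (@compact_closed C); last exact: compact_set1.
exact: (@norm_hausdorff C C^o).
Qed.

(** Parametrizing by the unit sphere avoids the condition that the rank be 1, which is not
    closed. *)
Lemma rank1_projector_compact n : compact [set p : 'M[C]_n | rank1_projector p].
Proof.
have -> : [set p : 'M[C]_n | rank1_projector p] =
    @proj_row C n @` [set v | unit_row v].
  apply/seteqP; split=> [p /rank1_projectorP[v uv ->]|_ [v uv <-]].
    by exists v.
  exact: proj_row_rank1.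
apply: continuous_compact; last exact: unit_row_compact.
apply: continuous_subspaceT; apply: continuous_mx => i j.
have -> : (fun v : 'rV[C]_n => proj_row v i j) = fun v => (v 0 i)^* * v 0 j.
  by apply/funext => v; rewrite mxE big_ord1 !mxE.
apply: continuous_mulC; last exact: coord_continuous.
by apply: continuous_conjC; exact: coord_continuous.
Qed.

Lemma pure_product_compact : compact (@pure_product R N d).
Proof.
have -> : @pure_product R N d = @tensor R N d @`
    [set p | forall I, [set q | rank1_projector q] (p I)].
  by apply/seteqP; split=> [_ [p pr ->]|_ [p pr <-]]; exists p.
pose T := prod_topology (fun I : 'I_N => 'M[C]_(d I)).
apply: (@continuous_compact T op); last first.
  exact: (tychonoff (fun I => @rank1_projector_compact (d I))).
apply: (@continuous_subspaceT T op); apply: continuous_mx => i j.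
have -> : (fun p : T => tensor p i j) = fun p => \prod_(I < N)
    p I ((enum_val i : mindex d) I) ((enum_val j : mindex d) I).
  by apply/funext => p; rewrite mxE.
apply: continuous_prodC => I p.
apply: (@continuous_comp T 'M[C]_(d I) C (fun p => p I)
  (fun M => M ((enum_val i : mindex d) I) ((enum_val j : mindex d) I))).
  exact: (@proj_continuous _ (fun I : 'I_N => 'M[C]_(d I))).
exact: coord_continuous.
Qed.

Lemma pure_product_entry (P : op) a b : pure_product P -> `|P a b| <= 1.
Proof.
move=> [p pr ->]; rewrite mxE normr_prod.
apply: prodr_ile1 => I _; rewrite normr_ge0 /=.
have [v uv ->] := (rank1_projectorP _).1 (pr I).
rewrite mxE big_ord1 !mxE normrM norm_conjC.
by rewrite mulr_ile1 // unit_row_entry.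
Qed.

Lemma pure_product_hermsym (P : op) : pure_product P -> P^t* = P.
Proof.
move=> [p pr ->]; rewrite tensor_trmxC; congr tensor.
apply: functional_extensionality_dep => I; apply/eqP; rewrite -hermsymmx_trmxC.
by have [] := pr I.
Qed.

Lemma continuous_trace_mul (Z : op) : continuous (fun P : op => \tr (Z *m P)).
Proof.
have -> : (fun P : op => \tr (Z *m P)) =
    fun P => \sum_i \sum_j Z i j * P j i.
  by apply/funext => P; apply: eq_bigr => i _; rewrite mxE.
apply: continuous_sumC => i; apply: continuous_sumC => j.
by apply: continuous_mulC; [exact: continuous_cstC|exact: coord_continuous].
Qed.

Lemma continuous_trp (X : op) : continuous (trp X).
Proof.
by apply: continuous_ReC; exact: continuous_trace_mul. Qed.

(** The l^1 norm of the entries, read in [R] because matrix norms are complex numbers here. It is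
    dual to the entrywise sup norm, which is at most 1 on pure product states, so it bounds Tr(XP)
    uniformly in P. *)
Definition entry_norm (X : op) : R := complex.Re (\sum_i \sum_j `|X i j|).

Lemma entry_normE (X : op) : ((entry_norm X)%:C)%C = \sum_i \sum_j `|X i j|.
Proof.
rewrite RRe_real // ger0_real // sumr_ge0 // => i _; exact: sumr_ge0.
Qed.

Lemma continuous_entry_norm (X : op) :
  continuous (fun Y : op => entry_norm (X - Y)).
Proof.
apply: continuous_ReC; apply: continuous_sumC => i; apply: continuous_sumC => j.
apply: continuous_normC.
have -> : (fun Y : op => (X - Y) i j) = fun Y => X i j - Y i j.
  by apply/funext => Z; rewrite !mxE.
by apply: continuous_subC; [exact: continuous_cstC|exact: coord_continuous].
Qed.

Lemma trp_le (c : R) (X Y : op) :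
  (forall a b, `|Y a b| <= (c%:C)%C) -> `|trp X Y| <= entry_norm X * c.
Proof.
move=> Yc; rewrite -lecR rmorphM /= entry_normE mulr_suml.
apply: le_trans (normc_ge_Re _) _.
apply: le_trans (ler_norm_sum _ _ _) _; apply: ler_sum => i _; rewrite mxE.
rewrite mulr_suml; apply: le_trans (ler_norm_sum _ _ _) _.
by apply: ler_sum => j _; rewrite normrM ler_wpM2l.
Qed.

Lemma trp_pure_le (X P : op) : pure_product P -> `|trp X P| <= entry_norm X.
Proof.
move=> pP; rewrite -[leRHS]mulr1; apply: trp_le => a b.
exact: pure_product_entry.
Qed.

Lemma trpD (X Y P : op) : trp (X + Y) P = trp X P + trp Y P.
Proof. by rewrite /trp mulmxDl mxtraceD raddfD. Qed.

Lemma trpN (X P : op) : trp (- X) P = - trp X P.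
Proof. by rewrite /trp mulNmx raddfN /= raddfN. Qed.

Lemma trpZ (r : R) (X P : op) : trp ((r%:C)%C *: X) P = r * trp X P.
Proof.
rewrite /trp -scalemxAl mxtraceZ; case: (\tr _) => x y /=.
by rewrite mul0r subr0.
Qed.

(** The conjugate of Tr(XP) is Tr(PX), hence the trace is real. This lets vanishing of [trp] be
    upgraded to vanishing of the complex trace. *)
Lemma trp_selfadjoint (X P : op) : selfadjoint X -> pure_product P ->
  \tr (X *m P) = ((trp X P)%:C)%C.
Proof.
rewrite /selfadjoint /= hermsymmx_trmxC => /eqP Xh pP.
rewrite RRe_real // CrealE -trace_map_mx -mxtrace_tr map_trmx trmxC_mul.
by rewrite Xh pure_product_hermsym // mxtrace_mulC.
Qed.

End PureProductTopology.

(** * Integration against [sigma] and its null sets *)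

Section Measure.
Variables (R : realType) (N : nat) (d : 'I_N -> nat).
Variable sigma : probability (borel_op R d) R.
Hypothesis sigma_inv : invariant_pure_measure sigma.
Local Notation C := (cplx R).
Local Notation op := (op R d).
Local Notation pure := (@pure_product R N d).

Lemma pure_product_mass :
  (sigma : {measure set (borel_op R d) -> \bar R}) pure = 1%E.
Proof. exact: sigma_inv.1. Qed.

Lemma open_measurable_op (A : set op) :
  open A -> measurable (A : set (borel_op R d)).
Proof. exact: sub_sigma_algebra. Qed.

Lemma pure_product_measurable : measurable (pure : set (borel_op R d)).
Proof.
rewrite -[pure]setCK; apply: measurableC; apply: open_measurable_op.
apply: closed_openC; apply: compact_closed; first exact: norm_hausdorff.
exact: pure_product_compact.
Qed.

Lemma continuous_measurable_op (f : op -> R) (D : set (borel_op R d)) :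
  continuous f -> measurable_fun D (f : borel_op R d -> R).
Proof.
move=> fc; apply: (@measurable_funS _ _ _ _ setT) => //.
apply: (measurability _ (measurable_realfun.RGenOpens.measurableE R)).
move=> _ [_ [x [y ->]] <-]; rewrite setTI; apply: open_measurable_op.
by apply: open_comp => // z _; exact: fc.
Qed.

Lemma continuous_integrable_pure (f : op -> R) :
  continuous f -> sigma.-integrable (pure : set (borel_op R d)) (EFin \o f).
Proof.
move=> fc; apply: measurable_bounded_integrable.
- exact: pure_product_measurable.
- by rewrite pure_product_mass ltry.
- exact: continuous_measurable_op.
- have /compact_bounded [M [Mr fM]] : compact (f @` pure).
    apply: continuous_compact; last exact: pure_product_compact.
    exact: continuous_subspaceT.
  by exists M; split => // x Mx P /= pP; apply: fM => //; exists P.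
Qed.

(** Defined with the complex trace and for all matrices, so that vanishing passes to complex linear
    combinations; [trp] is only real-linear. *)
Definition nonzero_on (Z : op) : set (borel_op R d) :=
  [set P : op | \tr (Z *m P) != 0].

Lemma nonzero_on_measurable (Z : op) : measurable (nonzero_on Z).
Proof.
apply: open_measurable_op.
apply: (@open_comp op C (fun P => \tr (Z *m P)) [set z | z != 0]).
  by move=> P _; exact: continuous_trace_mul.
have -> : [set z : C | z != 0] = ~` [set 0].
  by apply/seteqP; split=> z /=; [move=> /eqP|move=> /eqP].
apply: closed_openC; apply: (@compact_closed C); last exact: compact_set1.
exact: (@norm_hausdorff C C^o).
Qed.

Lemma trace_conj_by (U Z P : op) :
  \tr (U^t* *m Z *m U *m P) = \tr (Z *m conj_by U P).
Proof. by rewrite /conj_by -!mulmxA mxtrace_mulC -!mulmxA. Qed.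

(** By cyclicity of the trace the new exceptional set is the preimage of the old one under
    [conj_by (tensor U)], and [sigma] is invariant. *)
Lemma nonzero_on_conj (U : forall I : 'I_N, 'M[C]_(d I)) (Z : op) :
  (forall I, U I \is unitarymx) -> sigma.-negligible (nonzero_on Z) ->
  sigma.-negligible (nonzero_on ((tensor U)^t* *m Z *m tensor U)).
Proof.
move=> Uu /(negligibleP _ (nonzero_on_measurable Z)) Z0.
apply/negligibleP; first exact: nonzero_on_measurable.
rewrite -[RHS]Z0 -[RHS](sigma_inv.2 U Uu); last exact: nonzero_on_measurable.
congr (sigma _); apply/funext => P.
by rewrite /nonzero_on /= trace_conj_by.
Qed.

(* Matrices [Z] with [tr (Z P) = 0] almost surely form a finite-dimensional
   space, so one state [P] annihilates all of them; this space is stable under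
   conjugation by local unitaries, which act transitively on the states. *)
Lemma negligible_nonzero_on_eq0 (Z : op) :
  sigma.-negligible (nonzero_on Z) -> Z = 0.
Proof.
move=> Z0.
have [m [A [SA spanA]]] := exists_spanning_mx
  [set v | sigma.-negligible (nonzero_on (vec_mx v))].
have [P pP AP] : exists2 P, pure P & forall i, \tr (vec_mx (row i A) *m P) = 0.
  (* Otherwise the exceptional sets of the rows of [A], finitely many null sets, would cover [pure],
     which has mass 1. *)
  apply: contrapT => noP.
  have : sigma.-negligible pure.
    apply: (@negligibleS _ _ _ _
      (\big[setU/set0]_(i < m) nonzero_on (vec_mx (row i A)))).
      move=> P pP; apply: contrapT => nP; apply: noP; exists P => // i.
      apply/eqP; apply: contrapT => /negP nz; apply: nP.
      by rewrite -bigcup_seq; exists i => //=; rewrite mem_index_enum.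
    elim/big_ind : _ => [|B1 B2|i _].
    - exact: negligible_set0.
    - exact: negligibleU.
    - exact: SA.
  move=> /(negligibleP _ pure_product_measurable) mass0.
  by have /eqP := etrans (esym pure_product_mass) mass0; rewrite onee_eq0.
apply: pure_product_separating => Q pQ.
have [U Uu ->] := pure_product_transitive pP pQ.
rewrite -trace_conj_by.
set Z' := (tensor U)^t* *m Z *m tensor U.
  have /submxP[w Zw] : (mxvec Z' <= A)%MS.
    by apply: spanA; rewrite /= mxvecK; exact: nonzero_on_conj.
  rewrite -(mxvecK Z') Zw mulmx_sum_row linear_sum mulmx_suml raddf_sum big1 //=.
  by move=> i _; rewrite linearZ -scalemxAl /= mxtraceZ AP mulr0.
Qed.

Lemma integral_eq0_selfadjoint (Z : op) (f : op -> R) :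
  selfadjoint Z -> continuous f -> (forall P, pure P -> 0 <= f P) ->
  (forall P, pure P -> f P = 0 -> trp Z P = 0) ->
  \int[sigma]_(P in pure) f P = 0 -> Z = 0.
Proof.
move=> Zh fc f0 fZ If0; apply: negligible_nonzero_on_eq0.
have mp := pure_product_measurable.
have fi := continuous_integrable_pure fc.
have /(ae_eq_integral_abs _ mp) :
    (\int[sigma]_(P in pure) `|(EFin \o f) P| = 0)%E.
  transitivity (\int[sigma]_(P in pure) (EFin \o f) P)%E.
    by apply: eq_integral => P /set_mem pP /=; rewrite ger0_norm // f0.
  by rewrite -[LHS]fineK ?(integrable_fin_num _ fi) //; congr (_%:E).
move=> /(_ (measurable_int _ fi)) fae.
(* [sigma] lives on all operators and [nonzero_on] is not confined to [pure], so the complement must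
   be discarded as well. *)
have npure : sigma.-negligible (~` pure).
  apply/negligibleP; first exact: measurableC.
  apply: etrans (probability_setC sigma mp) _.
  by rewrite [X in (_ - X)%E](sigma_inv.1) subee.
apply: negligibleS (negligibleU npure fae) => P nz.
have [pP|] := pselect (pure P); [right|by left].
rewrite /= => /(_ pP) [fP]; move: nz.
by rewrite /nonzero_on /= trp_selfadjoint // fZ // eqxx.
Qed.

End Measure.

(** * Comparison of (1 + t/n)^n with e^t *)

Section Compound.
Variable R : realType.
Implicit Types (t : R) (n : nat).

Lemma bernoulli_le (y : R) n : 0 <= y <= 1 -> 1 - y *+ n <= (1 - y) ^+ n.
Proof.
move=> /andP[y0 y1]; elim: n => [|n IH]; first by rewrite mulr0n subr0 expr0.
rewrite exprS mulrBl mul1r mulrS opprD addrCA [leLHS]addrC -/(_ - _).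
rewrite lerB // ler_piMr // exprn_ile1 ?subr_ge0 // gerBl //.
Qed.

(** Raising 1 + x <= e^x to the power [n] requires a nonnegative base, which is what the bound on
    [t] provides. *)
Lemma compound_le_expR t n : (0 < n)%N -> `|t| <= n%:R ->
  (1 + t / n%:R) ^+ n <= expR t.
Proof.
move=> n0 tn; have n0R : 0 < n%:R :> R by rewrite ltr0n.
have -> : expR t = expR (t / n%:R) ^+ n.
  by rewrite -expRM_natl; congr expR; rewrite mulrC divfK // gt_eqF.
apply: lerXn2r; rewrite ?nnegrE ?expR_ge0 ?expR_ge1Dx //.
rewrite -lerBlDl sub0r lerNl -mulNr ler_pdivrMr // mul1r.
by rewrite (le_trans _ tn) // -normrN ler_norm.
Qed.

(** With x = t/n, (1 + x)^n e^(-t) >= ((1 + x)(1 - x))^n = (1 - x^2)^n >= 1 - n x^2 = 1 - t^2/n, by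
    1 - x <= e^(-x) and Bernoulli; then multiply by e^t. *)
Lemma expR_sub_compound t n : (0 < n)%N -> `|t| <= n%:R ->
  expR t - (1 + t / n%:R) ^+ n <= expR t * (t ^+ 2 / n%:R).
Proof.
move=> n0 tn; have n0R : 0 < n%:R :> R by rewrite ltr0n.
pose x := t / n%:R.
have x1 : `|x| <= 1 by rewrite normrM normfV normr_nat ler_pdivrMr // mul1r.
have [xl xu] : -1 <= x /\ x <= 1 by apply/andP; rewrite -ler_norml.
have tx : t = n%:R * x by rewrite /x mulrC divfK // gt_eqF.
have x2 : 0 <= x ^+ 2 <= 1.
  by rewrite sqr_ge0 /= -real_normK ?num_real // exprn_ile1.
have h : 1 - t ^+ 2 / n%:R <= (1 + x) ^+ n * expR (- t).
  have -> : expR (- t) = expR (- x) ^+ n by rewrite -expRM_natl tx mulrN.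
  rewrite -exprMn; apply: (@le_trans _ _ ((1 - x ^+ 2) ^+ n)).
    apply: le_trans (bernoulli_le n x2).
    have -> : t ^+ 2 / n%:R = n%:R * x ^+ 2 by rewrite tx; field; rewrite gt_eqF.
    by rewrite mulr_natl.
  apply: lerXn2r; rewrite ?nnegrE ?mulr_ge0 ?expR_ge0 ?subr_ge0 //.
  - by case/andP: x2.
  - by rewrite -lerBlDl sub0r.
  rewrite (_ : 1 - x ^+ 2 = (1 + x) * (1 - x)); last first.
    by rewrite mulrC -subr_sqr expr1n.
  by rewrite ler_wpM2l ?expR_ge1Dx // -lerBlDl sub0r.
have := ler_wpM2l (expR_ge0 t) h.
rewrite mulrCA -expRD subrr expR0 mulr1 mulrBr mulr1 lerBlDr => h'.
by rewrite lerBlDl.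
Qed.

End Compound.

(** * Comparison of [Gk] with [Ginf], local Lipschitz bound, uniqueness of the minimizer *)

Section Minimizers.
Variables (R : realType) (N : nat) (d : 'I_N -> nat).
Variable sigma : probability (borel_op R d) R.
Hypothesis sigma_inv : invariant_pure_measure sigma.
Local Notation C := (cplx R).
Local Notation op := (op R d).
Local Notation pure := (@pure_product R N d).
Local Notation expect f := (\int[sigma]_(P in pure) f P).
Implicit Types (X Y B : op) (f g : op -> R).

Lemma continuous_subR f g :
  continuous f -> continuous g -> continuous (fun P => f P - g P).
Proof.
by move=> fc gc P; exact: (@cvgB R R^o op (nbhs P) _ f g _ _ (fc P) (gc P)).
Qed.

Lemma expectB f g : continuous f -> continuous g ->
  \int[sigma]_(P in pure) (f P - g P) = expect f - expect g.
Proof.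
move=> fc gc; apply: RintegralB; first exact: pure_product_measurable.
- exact: continuous_integrable_pure.
- exact: continuous_integrable_pure.
Qed.

Lemma le_expect f g : continuous f -> continuous g ->
  (forall P, pure P -> f P <= g P) -> expect f <= expect g.
Proof.
move=> fc gc fg; apply: (@le_Rintegral _ (borel_op R d) R sigma pure) => //.
- exact: pure_product_measurable.
- exact: continuous_integrable_pure.
- exact: continuous_integrable_pure.
Qed.

Lemma expect_cst (r : R) : \int[sigma]_(P in pure) r = r.
Proof.
rewrite Rintegral_cst; last exact: pure_product_measurable.
by rewrite [X in fine X](pure_product_mass sigma_inv) mulr1.
Qed.

Lemma expect_le_cst f (c : R) : continuous f ->
  (forall P, pure P -> f P <= c) -> expect f <= c.
Proof.
move=> fc fle; rewrite -[leRHS]expect_cst; apply: le_expect => //.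
exact: cst_continuous.
Qed.

Lemma continuous_expR_trp X : continuous (fun P => expR (trp X P)).
Proof.
move=> P; apply: (@continuous_comp op R R (trp X) (@expR R)).
  exact: continuous_trp.
exact: continuous_expR.
Qed.

Lemma continuous_compound_trp X n :
  continuous (fun P => (1 + trp X P / n%:R) ^+ n).
Proof.
pose g t : R := (1 + t / n%:R) ^+ n; suff gc : continuous g.
  move=> P; apply: (@continuous_comp op R R (trp X) g); last exact: gc.
  exact: continuous_trp.
move=> t.
apply: (@continuous_comp R R R (fun t => 1 + t / n%:R) (fun s => s ^+ n)).
  by apply: cvgD; [exact: cvg_cst|apply: cvgMr_tmp; exact: cvg_id].
exact: exprn_continuous.
Qed.

Lemma Gk_le_Ginf (rho X : op) k : (0 < k)%N -> entry_norm X <= (2 * k)%:R ->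
  Gk sigma rho k X <= Ginf sigma rho X.
Proof.
move=> k0 Xk; rewrite lerB // le_expect //.
- exact: continuous_compound_trp.
- exact: continuous_expR_trp.
move=> P pP; apply: compound_le_expR; first by rewrite muln_gt0.
exact: le_trans (trp_pure_le _ pP) Xk.
Qed.

(** The pointwise error is bounded by a constant, and [sigma] has mass 1. This constant depends on
    [X] only through [M], so it tends to zero along a bounded sequence. *)
Lemma Ginf_le_Gk (rho X : op) (M : R) k : (0 < k)%N ->
  entry_norm X <= M -> M <= (2 * k)%:R ->
  Ginf sigma rho X <= Gk sigma rho k X + expR M * (M ^+ 2 / (2 * k)%:R).
Proof.
move=> k0 XM Mk; rewrite /Ginf /Gk addrAC lerB // -lerBlDl.
have ec := @continuous_expR_trp X; have cc := @continuous_compound_trp X (2 * k).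
rewrite -(expectB ec cc); apply: expect_le_cst => [P|P pP].
  by apply: continuous_subR P.
have tM : `|trp X P| <= M by exact: le_trans (trp_pure_le _ pP) XM.
have k2 : (0 < 2 * k)%N by rewrite muln_gt0.
apply: le_trans (expR_sub_compound k2 (le_trans tM Mk)) _.
have t2M2 : trp X P ^+ 2 <= M ^+ 2.
  rewrite -real_normK ?num_real // lerXn2r ?nnegrE //.
  exact: le_trans (normr_ge0 _) tM.
apply: ler_pM; first exact: expR_ge0.
- by rewrite mulr_ge0 ?sqr_ge0 // invr_ge0.
- by rewrite ler_expR; exact: le_trans (ler_norm _) tM.
- by rewrite ler_wpM2r // invr_ge0.
Qed.

(** From e^x - e^y <= e^x (x - y): the Lipschitz factor involves [X] alone, so with [X] the cluster
    point it is a fixed number. *)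
Lemma Ginf_sub_le (rho X Y : op) :
  Ginf sigma rho X - Ginf sigma rho Y <=
  entry_norm (X - Y) * (expR (entry_norm X) + complex.Re `|rho|).
Proof.
have -> : Ginf sigma rho X - Ginf sigma rho Y =
    (\int[sigma]_(P in pure) expR (trp X P) -
     \int[sigma]_(P in pure) expR (trp Y P)) +
    (- trp (X - Y) rho).
  by rewrite /Ginf trpD trpN !opprD !opprK addrACA.
rewrite mulrDr; apply: lerD; last first.
  apply: le_trans (ler_norm _) _; rewrite normrN; apply: trp_le => a b.
  rewrite RRe_real ?normr_real //; exact: mx_norm_entry.
have Xc := @continuous_expR_trp X; have Yc := @continuous_expR_trp Y.
rewrite -(expectB Xc Yc); apply: expect_le_cst => [P|P pP].
  by apply: continuous_subR P.
have tXY : trp Y P = trp X P - trp (X - Y) P.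
  by rewrite trpD trpN opprB addrC subrK.
rewrite tXY expRD.
have /(ler_wpM2l (expR_ge0 (trp X P))) := expR_ge1Dx (- trp (X - Y) P).
rewrite mulrDr mulr1 => h.
apply: (@le_trans _ _ (expR (trp X P) * trp (X - Y) P)).
  by rewrite lerBlDr -lerBlDl -mulrN.
rewrite mulrC; apply: le_trans (ler_norm _) _; rewrite normrM.
apply: ler_pM => //; first exact: trp_pure_le.
rewrite ger0_norm ?expR_ge0 // ler_expR.
exact: le_trans (ler_norm _) (trp_pure_le _ pP).
Qed.

(** If G(X) <= G(B), the midpoint [Y] satisfies G(X) + G(B) <= 2 G(Y). The linear terms cancel in
    G(X) + G(B) - 2 G(Y), which is thus the integral of a square and must be zero. By injectivity of
    exp, Tr((X - B)P) = 0 almost surely. *)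
Lemma Ginf_minimizer_strict (rho B : op) :
  minimal_point (Ginf sigma rho) B -> strict_minimum (Ginf sigma rho) B.
Proof.
move=> [Bh Bmin]; split=> // X Xh XB; rewrite ltNge; apply/negP => XleB.
apply: XB; apply/eqP; rewrite -subr_eq0; apply/eqP.
pose Y : op := ((2^-1)%:C)%C *: (X + B).
have Yh : selfadjoint Y.
  move: Xh Bh; rewrite /selfadjoint /= !hermsymmx_trmxC => /eqP Xh /eqP Bh.
  by rewrite /Y trmxCZ trmxCD Xh Bh (conj_Creal _) // complex_real.
have XBh : selfadjoint (X - B).
  move: Xh Bh; rewrite /selfadjoint /= !hermsymmx_trmxC => /eqP Xh /eqP Bh.
  by rewrite trmxCD -scaleN1r trmxCZ Xh Bh rmorphN rmorph1.
have trpY P : trp Y P = (trp X P + trp B P) / 2 by rewrite trpZ trpD mulrC.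
(* (e^{a/2} - e^{b/2})^2 = e^a + e^b - 2 e^{(a+b)/2} *)
pose f P := (expR (trp X P) - expR (trp Y P)) - (expR (trp Y P) - expR (trp B P)).
have fE P : f P = (expR (trp X P / 2) - expR (trp B P / 2)) ^+ 2.
  have half (a : R) : expR a = expR (a / 2) ^+ 2.
    by rewrite -expRM_natl mulrC divfK // pnatr_eq0.
  rewrite /f trpY mulrDl expRD (half (trp X P)) (half (trp B P)) sqrrB.
  by move: (expR _) (expR _) => a b; ring.
have ec (Z : op) := @continuous_expR_trp Z.
have ec2 (Z W : op) : continuous (fun P => expR (trp Z P) - expR (trp W P)).
  exact: (continuous_subR (@ec Z) (@ec W)).
have fc : continuous f by exact: (continuous_subR (@ec2 X Y) (@ec2 Y B)).
apply: (integral_eq0_selfadjoint sigma_inv XBh fc).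
- by move=> P _; rewrite fE sqr_ge0.
- move=> P _; rewrite fE => /eqP; rewrite sqrf_eq0 subr_eq0 => /eqP /expR_inj.
  by rewrite trpD trpN; move: (trp X P) (trp B P) => x b h; lra.
apply/eqP; rewrite eq_le; apply/andP; split; last first.
  by apply: Rintegral_ge0 => P _; rewrite fE sqr_ge0.
have -> : \int[sigma]_(P in pure) f P =
    (\int[sigma]_(P in pure) expR (trp X P) -
     \int[sigma]_(P in pure) expR (trp Y P)) -
    (\int[sigma]_(P in pure) expR (trp Y P) -
     \int[sigma]_(P in pure) expR (trp B P)).
  exact: (etrans (expectB (@ec2 X Y) (@ec2 Y B)) (congr2 (fun a b : R => a - b)
    (expectB (@ec X) (@ec Y)) (expectB (@ec Y) (@ec B)))).
have arith (x b eX eY eB : R) : eX - x <= eB - b ->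
    eB - b <= eY - (x + b) / 2 -> eX - eY - (eY - eB) <= 0 by lra.
by move: XleB (Bmin Y Yh); rewrite /Ginf trpY; exact: arith.
Qed.

Lemma selfadjoint_closed : closed (@selfadjoint R N d).
Proof.
pose g (ij : 'I_#|mindex d| * 'I_#|mindex d|) (X : op) :=
  X ij.1 ij.2 - (X ij.2 ij.1)^*.
have -> : @selfadjoint R N d = \bigcap_(ij in setT) (g ij @^-1` [set 0]).
  apply/seteqP; split=> X; rewrite /selfadjoint /= hermsymmx_trmxC.
    by move=> /eqP Xh [i j] _ /=; rewrite /g -[in X in X - _]Xh !mxE subrr.
  move=> gX; apply/eqP/matrixP => i j; have /eqP := gX (i, j) I.
  by rewrite /g subr_eq0 !mxE => /eqP ->.
apply: closed_bigI => ij _; apply: (continuous_closedP _).1.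
  apply: continuous_subC; first exact: coord_continuous.
  by apply: continuous_conjC; exact: coord_continuous.
apply: (@compact_closed C); last exact: compact_set1.
exact: (@norm_hausdorff C C^o).
Qed.

Lemma entry_norm_ge0 X : 0 <= entry_norm X.
Proof.
by rewrite -lecR entry_normE; apply: sumr_ge0 => i _; exact: sumr_ge0.
Qed.

Lemma entry_norm_bounded (c : R) X : `|X| <= (c%:C)%C ->
  entry_norm X <= \sum_(i < #|mindex d|) \sum_(j < #|mindex d|) c.
Proof.
move=> Xc; rewrite -lecR entry_normE rmorph_sum; apply: ler_sum => i _.
rewrite rmorph_sum; apply: ler_sum => j _.
exact: le_trans (mx_norm_entry _ _ _) Xc.
Qed.

Lemma nbhs_entry_norm_lt (B : op) (e : R) : 0 < e ->
  nbhs B [set Y | entry_norm (B - Y) < e].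
Proof.
move=> e0; have /(@cvgrPdist_lt R R^o) := @continuous_entry_norm R N d B B.
move=> /(_ e e0); apply: filterS => Y /=.
have -> : entry_norm (B - B) = 0.
  rewrite /entry_norm subrr big1 // => i _.
  by rewrite big1 // => j _; rewrite mxE normr0.
by rewrite sub0r normrN ger0_norm // entry_norm_ge0.
Qed.

(** * Cluster points of the sequence of minimizers and its convergence *)

Section MinimizingSequence.
Variables (rho : op) (B : nat -> op).
Hypothesis B_min : forall k, (1 <= k)%N -> minimal_point (Gk sigma rho k) (B k).
Variable c : R.
Hypothesis B_le : forall k, (1 <= k)%N -> `|B k| <= (c%:C)%C.

Lemma cluster_minimal_point p :
  cluster (B @ \oo) p -> minimal_point (Ginf sigma rho) p.
Proof.
move=> clp; split.
  apply: selfadjoint_closed => W Wp; apply: clp => //.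
  (* Nothing is known about [B 0], hence the tail from index 1. *)
  by exists 1%N => // k /= k1; have [] := B_min k1.
move=> X Xh; apply/ler_addgt0Pr => e e0.
pose L : R := \sum_(i < #|mindex d|) \sum_(j < #|mindex d|) c.
have BL k : (1 <= k)%N -> entry_norm (B k) <= L.
  by move=> k1; apply: entry_norm_bounded; exact: B_le.
have L0 : 0 <= L by exact: le_trans (entry_norm_ge0 (B 1%N)) (BL 1%N isT).
(* Lipschitz factor of [Ginf_sub_le] at [p], plus 1. Half of [e] pays for the passage from [B k] to
   [p], the other half for the error of [Ginf_le_Gk]. *)
pose K := expR (entry_norm p) + complex.Re `|rho| + 1.
have r0 : 0 <= complex.Re `|rho|.
  by rewrite -lecR RRe_real ?normr_real //; exact: normr_ge0.
have K0 : 0 < K by rewrite ltr_wpDl // addr_ge0 ?expR_ge0.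
have eK : 0 < e / 2 / K by exact: divr_gt0 (divr_gt0 e0 (ltr0Sn _ _)) K0.
(* A sum of three nonnegative thresholds: [T <= 2k] forces at once [L <= 2k], [entry_norm X <= 2k]
   and an approximation error of at most [e / 2]. *)
pose T := L + entry_norm X + expR L * L ^+ 2 * 2 / e.
have T3 : 0 <= expR L * L ^+ 2 * 2 / e.
  by rewrite !mulr_ge0 ?expR_ge0 ?sqr_ge0 // invr_ge0 ltW.
have [_ [[k [k1 Tk] <-]] /= pB] : (B @` [set k | (1 <= k)%N /\ T <= (2 * k)%:R]) `&`
    [set Y | entry_norm (p - Y) < e / 2 / K] !=set0.
  apply: clp; last by exact: nbhs_entry_norm_lt eK.
  exists (Num.bound T).+1 => // k /= Tk; exists k => //; split.
    exact: leq_trans Tk.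
  apply: (@le_trans _ _ (Num.bound T)%:R).
    by apply/ltW; rewrite archi_boundP // !addr_ge0 // entry_norm_ge0.
  by rewrite ler_nat mul2n -addnn (leq_trans (ltnW Tk)) // leq_addr.
have X0 := entry_norm_ge0 X.
have Lk : L <= (2 * k)%:R by apply: le_trans Tk; rewrite /T; lra.
have Xk : entry_norm X <= (2 * k)%:R by apply: le_trans Tk; rewrite /T; lra.
have k0 : 0 < (2 * k)%:R :> R by rewrite ltr0n muln_gt0.
have Ek : expR L * (L ^+ 2 / (2 * k)%:R) <= e / 2.
  rewrite mulrA ler_pdivrMr //.
  have : expR L * L ^+ 2 * 2 / e <= (2 * k)%:R by apply: le_trans Tk; rewrite /T; lra.
  by rewrite ler_pdivrMr //; move: (expR L * _) => u h; lra.
have pK : Ginf sigma rho p - Ginf sigma rho (B k) <= e / 2.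
  apply: le_trans (Ginf_sub_le _ _ _) _.
  apply: (@le_trans _ _ (entry_norm (p - B k) * K)).
    by rewrite ler_wpM2l ?entry_norm_ge0 // lerDl.
  by rewrite -ler_pdivlMr // ltW.
have arith (u Gp GX Gk' GB GkX : R) : GX <= Gk' + u -> Gk' <= GkX -> GkX <= GB ->
    Gp - GX <= e / 2 -> u <= e / 2 -> Gp <= GB + e by lra.
exact: (arith _ _ _ _ _ _ (Ginf_le_Gk rho k1 (BL k k1) Lk) ((B_min k1).2 X Xh)
  (Gk_le_Ginf rho k1 Xk) pK Ek).
Qed.

(** Two cluster points would each be a strict minimum, so there is only one; a sequence that stays
    in a compact set and has a single cluster point converges to it. *)
Lemma minimizers_cvg : exists2 p,
  strict_minimum (Ginf sigma rho) p & B @ \oo --> p.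
Proof.
have BV c' : c <= c' -> (B @ \oo) (mx_box c').
  move=> cc'; exists 1%N => // k /= k1 i j; apply: csquare_norm_le.
  apply: le_trans (mx_norm_entry _ _ _) _; apply: le_trans (B_le k1) _.
  by rewrite lecR.
have [p [_ clp]] := mx_box_compact (fmap_proper_filter B _) (BV c (lexx c)).
have strict q : cluster (B @ \oo) q -> strict_minimum (Ginf sigma rho) q.
  by move=> clq; apply: Ginf_minimizer_strict; exact: cluster_minimal_point.
exists p; first exact: strict.
(* The box is enlarged to be a neighbourhood of [p], which may lie on the boundary of [mx_box c]. *)
pose c' := Num.max c (complex.Re `|p| + 1).
apply: (@compact_cluster_set1 _ p _ (mx_box c')).
- exact: norm_hausdorff.
- exact: mx_box_compact.
- apply/(@nbhs_normP C 'M[C]_#|mindex d|); exists 1 => //= Y /= pY i j; apply: csquare_norm_le.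
  apply: (@le_trans _ _ ((complex.Re `|p| + 1)%:C)%C); last first.
    by rewrite lecR /c' le_max lexx orbT.
  rewrite rmorphD /= RRe_real ?normr_real // rmorph1.
  apply: le_trans (mx_norm_entry _ _ _) _.
  have -> : Y = p - (p - Y) by rewrite opprB addrC subrK.
  by apply: le_trans (ler_normB _ _) _; rewrite lerD2l ltW.
- by apply: BV; rewrite /c' le_max lexx.
- apply/seteqP; split=> [q clq|q ->//].
  apply: contrapT => qp; have [ph pmin] := strict p clp; have [qh qmin] := strict q clq.
  have := lt_trans (pmin q qh qp) (qmin p ph (fun e => qp (esym e))).
  by rewrite ltxx.
Qed.

End MinimizingSequence.

End Minimizers.

Theorem theorem9 (R : realType) (N : nat) (d : 'I_N -> nat)
    (d_gt0 : forall I, (0 < d I)%N)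
    (sigma : probability (borel_op R d) R)
    (sigma_inv : invariant_pure_measure sigma)
    (rho : op R d) (rho_density : density rho)
    (B : nat -> op R d)
    (B_min : forall k, (1 <= k)%N -> minimal_point (Gk sigma rho k) (B k))
    (B_bounded : bounded_set (B @` [set k | (1 <= k)%N])) :
  cvgn B /\ strict_minimum (Ginf sigma rho) (limn B).
Proof.
have [M [Mr BM]] := B_bounded.
(* [bounded_set] bounds the norms by each number strictly above [M], hence [M + 1]; this complex
   number is real and so equals its real part. *)
have B_le k : (1 <= k)%N -> `|B k| <= ((complex.Re (M + 1))%:C)%C.
  move=> k1; rewrite RRe_real ?realD //.
  by apply: (BM (M + 1)); [rewrite ltrDl|exists k].
have [p pmin Bp] := minimizers_cvg sigma_inv B_min B_le.
have -> : limn B = p by exact: cvg_lim.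
by split=> //; apply/cvg_ex; exists p.
Qed.
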